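(* Let $(T_\xi)$ be a family of operators $T_\xi\colon\mathcal H\to\mathcal H$, with $\xi\sim\mathcal D$, such that $T_\xi$ is nonexpansive for $\mathcal D$-almost all $\xi$ and, for each $x\in\mathcal H$, the map $\xi\mapsto T_\xi x$ is measurable and Bochner integrable. Define $T\colon\mathcal H\to\mathcal H$ by $Tx=\mathbb E_{\xi\sim\mathcal D}[T_\xi x]$ and assume $\mathrm{Fix}(T)\neq\emptyset$. Assume that there exist some $p_0\in\mathrm{Fix}(T)$ and a constant $\sigma_*^2<+\infty$ such that $\mathbb E[\|(T_\xi-T)p_0\|^2]\le\sigma_*^2$. Then, for all $p\in\mathrm{Fix}(T)$, $$\mathbb E\left[\|(T_\xi-T)p\|^2\right]\le\sigma_*^2.$$
   Context: $\mathcal H$ is a real separable Hilbert space with norm $\|\cdot\|$, and $\mathcal D$ is a probability distribution. An operator $S\colon\mathcal H\to\mathcal H$ is nonexpansive if $\|Sx-Sy\|\le\|x-y\|$ for all $x,y\in\mathcal H$. $\mathrm{Fix}(T)=\{x\in\mathcal H\colon Tx=x\}$. $\mathbb E$ denotes expectation over $\xi\sim\mathcal D$. *)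

(* Defs.v *)
From HB Require Import structures.
From mathcomp Require Import all_boot all_order all_algebra sesquilinear.
From mathcomp Require Import all_classical all_reals all_analysis.
Set Implicit Arguments.
Unset Strict Implicit.
Unset Printing Implicit Defensive.
Import Order.TTheory GRing.Theory Num.Theory.
Import numFieldNormedType.Exports.
Local Open Scope classical_set_scope.
Local Open Scope ring_scope.

(* A real Hilbert space is a complete normed module whose norm is induced by
   an inner product: with the identity as conjugation, {dot H for idfun} is
   the type of symmetric positive definite bilinear forms on H. *)
HB.mixin Record CompleteNormedModule_isHilbert (R : realType) (H : Type)
    of CompleteNormedModule R H := {
  inner : {dot H for (@idfun R)} ;
  inner_norm : forall x : H, inner x x = `|x| ^+ 2
}.

#[short(type="hilbertType")]
HB.structure Definition Hilbert (R : realType) :=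
  { H of CompleteNormedModule R H & CompleteNormedModule_isHilbert R H }.

Definition separable (T : topologicalType) :=
  exists2 S : set T, countable S & dense S.

Definition nonexpansive (R : realType) (H : normedModType R) (S : H -> H) :=
  forall x y : H, `|S x - S y| <= `|x - y|.

Definition Fix (U : Type) (S : U -> U) : set U := [set x | S x = x].

Section Bochner.
Context (R : realType) (H : normedModType R).
Context (d : measure_display) (Xi : measurableType d) (P : probability Xi R).
Implicit Types (f : Xi -> H) (v : H).

(* H carries the Borel sigma-algebra, generated by its open sets. *)
Definition borel_measurable f :=
  measurable_fun [set: Xi] (f : Xi -> g_sigma_algebraType (@open H)).

Definition bochner_simple (s : Xi -> H) :=
  borel_measurable s /\ finite_set (range s).

Definition simple_integral (s : Xi -> H) : H :=
  \sum_(v \in range s) fine (P (s @^-1` [set v])) *: v.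

Definition bochner_approx f (s : nat -> Xi -> H) :=
  (forall n, bochner_simple (s n)) /\
  ((\int[P]_xi `|f xi - s n xi|%:E) @[n --> \oo] --> 0)%E.

(* Strong measurability is not listed separately: a function that is an L^1
   limit of simple functions is the almost everywhere limit of a subsequence.
   Borel measurability ensures that the integrals in bochner_approx are those
   of measurable functions. *)
Definition bochner_integrable f :=
  borel_measurable f /\ exists s, bochner_approx f s.

(* The limit of the integrals of approximating simple functions; for measurable
   f it does not depend on the approximating sequence. The value is 0 when there is no such
   limit, which does not happen if f is integrable and H is complete. *)
Definition bochner_integral f : H :=
  xget 0 [set v | exists2 s, bochner_approx f s &
                  simple_integral (s n) @[n --> \oo] --> v].

End Bochner.

(* Main.v *)
(* Let p, p0 be fixed points of T and h := p - p0. Almost surely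
   <h, T_xi p - T_xi p0> <= |h|^2 by Cauchy-Schwarz and nonexpansiveness, while
   the expectation of the left-hand side is <h, T p - T p0> = |h|^2. So equality
   holds almost surely, and the equality case of Cauchy-Schwarz gives
   T_xi p - T_xi p0 = h, that is T_xi p - p = T_xi p0 - p0: the two second
   moments are equal.
   The Bochner integral only enters through <h, E f> = E <h, f>. For simple
   approximations s_n of f, |E <h, f> - <h, E s_n>| <= |h| E |f - s_n|; taking
   h := E s_n - E s_m also shows that the integrals E s_n form a Cauchy sequence. *)

Require Import Defs.
From mathcomp Require Import all_boot all_order all_algebra sesquilinear.
From mathcomp Require Import finmap lra measurable_realfun.
From mathcomp Require Import all_classical all_reals all_analysis.
Set Implicit Arguments.
Unset Strict Implicit.
Unset Printing Implicit Defensive.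
Import Order.TTheory GRing.Theory Num.Theory.
Import numFieldNormedType.Exports.
Local Open Scope classical_set_scope.
Local Open Scope ring_scope.

(** * Cauchy-Schwarz and continuity of the inner product *)

Section InnerProduct.
Context (R : realType) (H : hilbertType R).
Implicit Types x y h : H.

Lemma innerC x y : inner x y = inner y x :> R.
Proof. by rewrite [LHS]hermC/= expr0 mul1r. Qed.

Lemma normB_sqr x y :
  `|x - y| ^+ 2 = `|x| ^+ 2 + `|y| ^+ 2 - 2 * inner x y :> R.
Proof. by rewrite -!inner_norm hnormB/= expr0 mul1r -mulr2n mulr_natl. Qed.

Lemma cauchy_schwarz h x : `|inner h x| <= `|h| * `|x|.
Proof.
have [->|h0] := eqVneq h 0; first by rewrite linear0l !normr0 mul0r.
have h2 : 0 < `|h| ^+ 2 by rewrite exprn_gt0// normr_gt0.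
rewrite -(@ler_pXn2r _ 2)// ?nnegrE ?mulr_ge0//.
rewrite real_normK ?num_real// exprMn.
set a := `|h| ^+ 2 in h2 *; set c := inner h x.
(* This vector is [a] times the component of [x] orthogonal to [h]. Its squared norm is a (a |x|^2 -
   c^2), and cancelling a > 0 gives the claim. *)
have := sqr_ge0 `|a *: x - c *: h|.
rewrite normB_sqr.
have -> : inner (a *: x) (c *: h) = a * (c * c) :> R.
  by rewrite linearZl_LR /= linearZr_LR /= -/c innerC.
rewrite !normrZ !exprMn !real_normK ?num_real// -/a => le0.
rewrite -(ler_pM2l h2).
nra.
Qed.

Lemma inner_continuous h : continuous (inner h : H -> R).
Proof.
move=> x; apply/cvgrPdist_lt => e e0; near=> y.
rewrite -raddfB (le_lt_trans (cauchy_schwarz _ _))//.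
(* The extra 1 keeps the divisor of [e] positive when h = 0. *)
have h1 : 0 < `|h| + 1 by rewrite ltr_wpDl.
rewrite (@le_lt_trans _ _ ((`|h| + 1) * `|x - y|))// ?ler_wpM2r ?lerDl//.
rewrite mulrC -ltr_pdivlMr//.
by near: y; apply: cvgr_dist_lt => //; rewrite divr_gt0.
Unshelve. all: by end_near. Qed.

End InnerProduct.

(** * Measurability of Borel and simple maps *)

Section Borel.
Context (R : realType) (H : normedModType R).
Context (d : measure_display) (Xi : measurableType d).
Implicit Types (f s : Xi -> H).

(** Open intervals generate the Borel sets of the line, and continuity of [g] pulls them back to
    generators of the sigma-algebra on [H]. *)
Lemma borel_measurable_comp f (g : H -> R) :
  borel_measurable f -> continuous g -> measurable_fun [set: Xi] (g \o f).
Proof.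
move=> mf /continuousP cg.
apply: (measurability _ (RGenOpens.measurableE R)).
move=> _ [_ [a [b ->] <-]]; rewrite comp_preimage; apply: mf => //; apply: sub_sigma_algebra.
exact/cg/interval_open.
Qed.

Lemma borel_measurable_preimage1 f v :
  borel_measurable f -> measurable (f @^-1` [set v]).
Proof.
move=> mf; rewrite -[X in measurable X]setTI -[[set v]]setCK.
apply: (mf) => //; apply: (@measurableC _ (g_sigma_algebraType (@open H))).
apply: sub_sigma_algebra; apply: closed_openC.
exact: (accessible_closed_set1 (hausdorff_accessible (@norm_hausdorff _ H))).
Qed.

(** Letting [g] depend on [xi] as well covers both the inner product of [h] with [s] and the
    distance from [s] to another map. *)
Lemma simple_sumE s (g : H -> Xi -> R) xi : finite_set (range s) ->
  g (s xi) xi =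
  \sum_(v <- fset_set (range s)) g v xi * \1_(s @^-1` [set v]) xi.
Proof.
move=> fs; rewrite (bigD1_seq (s xi)) ?fset_uniq//=; last first.
  by rewrite in_fset_set// inE; exists xi.
rewrite indicE mem_set// mulr1 big1 ?addr0// => v vs.
by rewrite indicE memNset ?mulr0//= => /esym/eqP; rewrite (negbTE vs).
Qed.

(** On each of the finitely many level sets of [s] the first argument of [g] is a constant.
    Distances |f - s| thus reduce to |f - v| with [v] fixed, a continuous function of [f] alone. *)
Lemma measurable_simple s (g : H -> Xi -> R) : bochner_simple s ->
  (forall v, measurable_fun [set: Xi] (g v)) ->
  measurable_fun [set: Xi] (fun xi => g (s xi) xi).
Proof.
move=> [ms fs] mg; under eq_fun do rewrite (simple_sumE _ _ fs).
apply: measurable_sum => v; apply: measurable_funM => //.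
by apply: measurable_indic; exact: borel_measurable_preimage1.
Qed.

End Borel.

(** * Exchanging the Bochner integral with the inner product *)

Section BochnerInner.
Context (R : realType) (H : hilbertType R).
Context (d : measure_display) (Xi : measurableType d) (P : probability Xi R).
Implicit Types (f s : Xi -> H) (h : H).

Lemma measurable_inner h f : borel_measurable f ->
  measurable_fun [set: Xi] (fun xi => inner h (f xi)).
Proof. by move=> mf; apply: borel_measurable_comp mf _; exact: inner_continuous. Qed.

Lemma integrable_inner_simple h s : bochner_simple s ->
  P.-integrable [set: Xi] (fun xi => (inner h (s xi))%:E).
Proof.
move=> [ms fs].
under eq_fun => xi do rewrite (simple_sumE (fun v _ => inner h v) xi fs) -sumEFin.
apply: integrable_sum => // v _; under eq_fun do rewrite EFinM.
apply: integrableZl => //; apply: integrable_indic.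
exact: borel_measurable_preimage1.
Qed.

Lemma integral_inner_simple h s : bochner_simple s ->
  (\int[P]_xi (inner h (s xi))%:E = (inner h (simple_integral P s))%:E)%E.
Proof.
move=> [ms fs]; have mp v := borel_measurable_preimage1 v ms.
under eq_integral => xi _ do
  rewrite (simple_sumE (fun v _ => inner h v) xi fs) -sumEFin.
rewrite integral_sum//; last first.
  move=> v; under eq_fun do rewrite EFinM.
  by apply: integrableZl => //; exact: integrable_indic.
rewrite /simple_integral fsbig_finite// linear_sumr -sumEFin; apply: eq_bigr => v _.
under eq_integral do rewrite EFinM.
rewrite integralZl ?integral_indic ?setIT//; last exact: integrable_indic.
by rewrite linearZr_LR/= [fine _ * _]mulrC EFinM fineK// fin_num_measure.
Qed.

(** By Cauchy-Schwarz, |<h, f - s>| is dominated by |h| |f - s|. This makes <h, f> = <h, f - s> +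
    <h, s> integrable and, once integrated, bounds the error. *)
Lemma integral_inner_approx h f s : borel_measurable f -> bochner_simple s ->
  (\int[P]_xi `|f xi - s xi|%:E < +oo)%E ->
  P.-integrable [set: Xi] (fun xi => (inner h (f xi))%:E) /\
  `|\int[P]_xi inner h (f xi) - inner h (simple_integral P s)| <=
    `|h| * fine (\int[P]_xi `|f xi - s xi|%:E)%E.
Proof.
move=> mf ss fin; have [ms fs] := ss.
have mN : measurable_fun [set: Xi] (fun xi => `|f xi - s xi|).
  apply: (measurable_simple (g := fun v xi => `|f xi - v|)) => // v.
  apply: (borel_measurable_comp (g := fun x => `|x - v|)) => // x.
  by apply: cvg_norm; apply: cvgB; [exact: cvg_id|exact: cvg_cst].
have iN : P.-integrable [set: Xi] (fun xi => `|f xi - s xi|%:E).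
  apply/integrableP; split; first exact/measurable_EFinP.
  by under eq_integral do rewrite gee0_abs ?lee_fin//.
have iB : P.-integrable [set: Xi] (fun xi => (inner h (f xi - s xi))%:E).
  apply: le_integrable (integrableZl measurableT `|h| iN) => //.
    apply/measurable_EFinP; under eq_fun do rewrite raddfB.
    by apply: measurable_funB; exact: measurable_inner.
  move=> xi _; rewrite -EFinM !abse_EFin lee_fin [leRHS]ger0_norm ?mulr_ge0//.
  exact: cauchy_schwarz.
have is_ := integrable_inner_simple h ss.
have if_ : P.-integrable [set: Xi] (fun xi => (inner h (f xi))%:E).
  apply: eq_integrable (integrableD measurableT iB is_) => // xi _.
  by rewrite /= -EFinD -raddfD subrK.
split=> //.
have -> : inner h (simple_integral P s) = \int[P]_xi inner h (s xi).
  by rewrite /Rintegral integral_inner_simple.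
rewrite -RintegralB// (le_trans (le_normr_Rintegral _ _))//.
  by apply: eq_integrable iB => // xi _; rewrite /= raddfB.
rewrite -[fine _]/(\int[P]_xi `|f xi - s xi|) -RintegralZl//.
apply: le_Rintegral => //.
- apply: eq_integrable (integrable_norm iB) => // xi _.
  by rewrite /= raddfB.
- by apply: eq_integrable (integrableZl measurableT `|h| iN).
- by move=> xi _; rewrite -raddfB; exact: cauchy_schwarz.
Qed.

(** Convergence to 0 in the extended reals allows finitely many infinite distances, hence the
    eventual form of the finiteness claim. *)
Lemma bochner_approx_fine f (s : nat -> Xi -> H) : bochner_approx P f s ->
  let e n := fine (\int[P]_xi `|f xi - s n xi|%:E)%E in
  (\forall n \near \oo, (\int[P]_xi `|f xi - s n xi|%:E < +oo)%E) /\
  e n @[n --> \oo] --> 0.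
Proof.
move=> [_ /fine_cvgP[fin cv]]; split=> //.
by apply: filterS fin => n; rewrite fin_numE ltey => /andP[].
Qed.

Lemma bochner_integrable_inner h f : bochner_integrable P f ->
  P.-integrable [set: Xi] (fun xi => (inner h (f xi))%:E).
Proof.
move=> [mf [s as_]]; have [[N _ fin] _] := bochner_approx_fine as_.
by have [] := integral_inner_approx h mf (as_.1 N) (fin N (leqnn N)).
Qed.

Lemma cvg_inner_simple_integral h f (s : nat -> Xi -> H) :
  borel_measurable f -> bochner_approx P f s ->
  inner h (simple_integral P (s n)) @[n --> \oo] --> \int[P]_xi inner h (f xi).
Proof.
move=> mf as_; have [fin cv] := bochner_approx_fine as_.
apply/subr_cvg0/norm_cvg0P.
apply: (squeeze_cvgr (f := fun=> 0) (h := fun n =>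
  `|h| * fine (\int[P]_xi `|f xi - s n xi|%:E)%E)).
- apply: filterS fin => n fn; rewrite normr_ge0 distrC /=.
  by have [] := integral_inner_approx h mf (as_.1 n) fn.
- exact: cvg_cst.
- by rewrite -(mulr0 `|h|); apply: cvgM cv; exact: cvg_cst.
Qed.

Lemma simple_integral_is_cvg f (s : nat -> Xi -> H) :
  borel_measurable f -> bochner_approx P f s ->
  cvg (simple_integral P (s n) @[n --> \oo]).
Proof.
move=> mf as_; have [fin cv] := bochner_approx_fine as_.
apply/cauchy_cvgP/cauchy_exP => e e0.
have e20 : 0 < e / 2 by rewrite divr_gt0.
have /cvgrPdist_lt/(_ _ e20) near_e := cv.
have [N _ HN] := filterI fin near_e.
exists (simple_integral P (s N)), N => // n Nn.
have [finN eN] := HN N (leqnn N); have [finn en] := HN n Nn.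
rewrite -ball_normE /ball_ /=.
set h := _ - _; have [->|h0] := eqVneq h 0; first by rewrite normr0.
have hp : 0 < `|h| by rewrite normr_gt0.
have [_ bN] := integral_inner_approx h mf (as_.1 N) finN.
have [_ bn] := integral_inner_approx h mf (as_.1 n) finn.
have {}eN : fine (\int[P]_xi `|f xi - s N xi|%:E)%E < e / 2.
  by move: eN; rewrite sub0r normrN; apply: le_lt_trans; exact: ler_norm.
have {}en : fine (\int[P]_xi `|f xi - s n xi|%:E)%E < e / 2.
  by move: en; rewrite sub0r normrN; apply: le_lt_trans; exact: ler_norm.
(* Write |h|^2 = <h, h> as a difference of inner products with the two simple integrals, and insert
   the integral of <h, f> between them. Each error is below |h| e / 2. *)
rewrite -(ltr_pM2l hp) -expr2 -inner_norm {2}/h raddfB.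
rewrite -[X in X - _](subrK (\int[P]_xi inner h (f xi))) -addrA.
rewrite (le_lt_trans (ler_norm _))// (le_lt_trans (ler_normD _ _))//.
rewrite [X in X + _]distrC (le_lt_trans (lerD bN bn))// -mulrDr ltr_pM2l//.
by rewrite [ltRHS]splitr ltrD.
Qed.

Lemma inner_bochner_integral h f : bochner_integrable P f ->
  inner h (bochner_integral P f) = \int[P]_xi inner h (f xi).
Proof.
move=> [mf [s as_]].
(* The simple integrals converge, so [xget] returns a genuine limit and not its default 0. *)
have [] : [set v | exists2 s, bochner_approx P f s &
    simple_integral P (s n) @[n --> \oo] --> v] (bochner_integral P f).
  apply: xgetPex; exists (lim (simple_integral P (s n) @[n --> \oo])).
  by exists s => //; exact: simple_integral_is_cvg mf as_.
move=> s' as' cv.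
(* The sequence [s'] behind the chosen value may differ from [s]. Both sides are limits of the same
   real sequence along [s'], hence equal. *)
have ch := cvg_inner_simple_integral (h := h) mf as'.
rewrite -(cvg_lim (@Rhausdorff R) ch); apply/esym/cvg_lim => //.
exact: continuous_cvg (@inner_continuous _ _ h _) cv.
Qed.

End BochnerInner.

(** Expanding the square gives |z - h|^2 = |z|^2 - |h|^2, which is at most 0. *)
Lemma cauchy_schwarz_eq (R : realType) (H : hilbertType R) (h z : H) :
  `|z| <= `|h| -> inner h z = `|h| ^+ 2 -> z = h.
Proof.
move=> zh hz; apply/eqP; rewrite -subr_eq0 -normr_eq0 -sqrf_eq0.
rewrite eq_le sqr_ge0 andbT normB_sqr innerC hz.
have : `|z| ^+ 2 <= `|h| ^+ 2 by rewrite ler_pXn2r ?nnegrE.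
lra.
Qed.

Lemma ae_eq_of_integral_eq d (T : measurableType d) (R : realType)
    (P : probability T R) (g : T -> R) (c : R) :
  P.-integrable [set: T] (EFin \o g) -> {ae P, forall t, g t <= c} ->
  \int[P]_t g t = c -> {ae P, forall t, g t = c}.
Proof.
move=> ig gc Eg.
have ic : P.-integrable [set: T] (EFin \o cst c).
  exact: finite_measure_integrable_cst.
have iB := integrableB measurableT ic ig.
have mB := measurable_int P iB.
(* Almost surely c - g is nonnegative and equals its absolute value; its integral is c - c = 0 since
   [P] has mass 1. *)
have : (\int[P]_t `|(c%:E - (g t)%:E)%E| = 0)%E.
  rewrite (@ae_eq_integral _ _ _ P setT (fun t => c%:E - (g t)%:E)%E)//.
  - rewrite integralB//= integral_cst// [X in (_ * X)%E](probability_setT P) mule1.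
    have -> : (\int[P]_t (g t)%:E = c%:E)%E.
      by rewrite -Eg /Rintegral fineK// integrable_fin_num.
    by rewrite subee.
  - exact: measurableT_comp.
  - by apply: filterS gc => t gt _; rewrite gee0_abs// lee_fin subr_ge0.
move/(ae_eq_integral_abs P measurableT mB); apply: filterS => t /(_ Logic.I).
by rewrite -EFinB => -[] /eqP; rewrite subr_eq0 => /eqP.
Qed.

Theorem mainTheorem1 (R : realType) (H : hilbertType R)
  (H_separable : separable H)
  (d : measure_display) (Xi : measurableType d) (D : probability Xi R)
  (T_ : Xi -> H -> H)
  (T_nonexpansive : {ae D, forall xi, nonexpansive (T_ xi)})
  (T_measurable : forall x : H, borel_measurable (fun xi => T_ xi x))
  (T_integrable : forall x : H, bochner_integrable D (fun xi => T_ xi x))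
  (T : H -> H)
  (T_def : forall x : H, T x = bochner_integral D (fun xi => T_ xi x))
  (Fix_nonempty : Fix T !=set0)
  (p0 : H) (p0_fix : Fix T p0)
  (sigma2 : R)
  (p0_bound : ('E_D[fun xi => (`|T_ xi p0 - T p0| ^+ 2)%R] <= sigma2%:E)%E) :
  forall p : H, Fix T p ->
    ('E_D[fun xi => (`|T_ xi p - T p| ^+ 2)%R] <= sigma2%:E)%E.
Proof.
move=> p p_fix; set h := p - p0.
have ip := bochner_integrable_inner h (T_integrable p).
have ip0 := bochner_integrable_inner h (T_integrable p0).
have iB : D.-integrable [set: Xi]
    (EFin \o (fun xi => inner h (T_ xi p - T_ xi p0))).
  apply: eq_integrable (integrableB measurableT ip ip0) => // xi _.
  by rewrite /= raddfB.
have EB : \int[D]_xi inner h (T_ xi p - T_ xi p0) = `|h| ^+ 2.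
  (* The difference is split at the level of real integrals. Each one then becomes an inner product
     with T p = p or T p0 = p0. *)
  under eq_Rintegral do rewrite raddfB.
  rewrite RintegralB// -!inner_bochner_integral// -!T_def p_fix p0_fix.
  by rewrite -raddfB; exact: inner_norm.
have leB : {ae D, forall xi, inner h (T_ xi p - T_ xi p0) <= `|h| ^+ 2}.
  apply: filterS T_nonexpansive => xi nxi.
  rewrite (le_trans (ler_norm _))// (le_trans (cauchy_schwarz _ _))// expr2.
  by rewrite ler_wpM2l.
have eqT : {ae D, forall xi, T_ xi p - T_ xi p0 = h}.
  have innerE := ae_eq_of_integral_eq iB leB EB.
  apply: filterS2 T_nonexpansive innerE => xi nxi.
  exact: cauchy_schwarz_eq.
have msq x : measurable_fun [set: Xi] (fun xi => (`|T_ xi x - T x| ^+ 2)%:E).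
  apply/measurable_EFinP/measurable_funX.
  apply: (borel_measurable_comp (g := fun y => `|y - T x|)) => // y.
  by apply: cvg_norm; apply: cvgB; [exact: cvg_id|exact: cvg_cst].
(* The inequality is proved as an equality of expectations, since the integrands agree almost surely
   by [eqT]. *)
apply: le_trans p0_bound; rewrite !unlock le_eqVlt; apply/orP; left; apply/eqP.
apply: ae_eq_integral => //; apply: filterS eqT => xi eqxi _.
suff -> : T_ xi p - T p = T_ xi p0 - T p0 by [].
rewrite p_fix p0_fix -[T_ xi p in LHS](subrK (T_ xi p0)) eqxi addrAC.
by rewrite /h (addrAC p) subrr sub0r addrC.
Qed.
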